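(* The following hold. (1) If $F$ is a predictable functional, then for all $(x,j)\in\Omega$, $t\in(0,T]$ and $z\in\mathbb{R}^d_0$, $$\nabla_X F(t,x_t,j_t)=0\qquad\text{and}\qquad (\nabla_J F)(t,z,x,j)=0 .$$ (2) Let $\mu$ be a $\sigma$-finite predictable measure, let $\psi:[0,T]\times\mathbb{R}^d_0\times\Omega\to\mathbb{R}$ be a non-anticipative functional field with compact support in $[0,T]\times\mathbb{R}^d_0$, and let $F$ be a non-anticipative functional of the form $$F(t,x_t,j_t)=\int_0^t\int_{\mathbb{R}^d_0}\psi(s,y,x_{s-},j_{s-})\,(j-\mu)(ds\,dy).$$ Then for all $(x,j)\in\Omega$, $t\in(0,T]$, $z\in\mathbb{R}^d_0$, $$(\nabla_J F)(t,z,x_t,j_t)=\psi(t,z,x_{t-},j_{t-})\qquad\text{and}\qquad \nabla_X F(t,x_t,j_t)=0 .$$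
   Context: Fix $T>0$, $d\ge 1$; $\mathbb{R}^d_0=\mathbb{R}^d\setminus\{0\}$. $\mathcal{D}_T=D([0,T],\mathbb{R}^d)$ is the space of càdlàg functions with the $\sigma$-algebra generated by the evaluations. $\mathcal{M}_T$ is the set of simple integer-valued measures $j$ on $[0,T]\times\mathbb{R}^d_0$, i.e. at most countable sums $j=\sum_i\delta_{(t_i,z_i)}$ of Dirac masses that are finite on compact subsets of $[0,T]\times\mathbb{R}^d_0$ (the times $t_i$ need be neither distinct nor ordered), with the $\sigma$-algebra generated by the maps $j\mapsto j(A)$, $A$ Borel. $\Omega=\mathcal{D}_T\times\mathcal{M}_T$ carries the product $\sigma$-algebra $\mathcal{F}$, and the canonical process is $(X,J)(x,j)=(x,j)$. $\mathcal{F}_t$ is the $\sigma$-algebra generated by the canonical process up to time $t$ (the values $x(s)$, $s\le t$, and the restriction of $j$ to $[0,t]\times\mathbb{R}^d_0$). For $x\in\mathcal{D}_T$: $x_t(u)=x(u)$ for $u\le t$, $x_t(u)=x(t)$ for $u>t$; $x_{t-}(u)=x(u)$ for $u<t$, $x_{t-}(u)=x(t-)$ for $u\ge t$. For $j\in\mathcal{M}_T$: $j_t(\cdot)=j(\cdot\cap([0,t]\times\mathbb{R}^d_0))$ and $j_{t-}(\cdot)=j(\cdot\cap([0,t)\times\mathbb{R}^d_0))$. A non-anticipative functional is a $\mathcal{B}([0,T])\otimes\mathcal{F}$-measurable map $F:[0,T]\times\Omega\to\mathbb{R}$ with $F(t,x,j)=F(t,x_t,j_t)$ and $F(t,\cdot)$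 $\mathcal{F}_t$-measurable for all $t$. It is predictable if moreover $F(t,x,j)=F(t,x_{t-},j_{t-})$ for all $(t,x,j)$. A non-anticipative functional field is a measurable map $\Psi:[0,T]\times\mathbb{R}^d_0\times\Omega\to\mathbb{R}$ with $\Psi(t,z,x,j)=\Psi(t,z,x_t,j_t)$ and $\Psi(t,z,\cdot)$ $\mathcal{F}_t$-measurable. Compact support of $\psi$ means that $\psi(\cdot,\cdot,\omega)$ vanishes outside a compact subset of $[0,T]\times\mathbb{R}^d_0$. A $\sigma$-finite predictable measure is a $\sigma$-finite measure $\mu(\cdot,x,j)$ on $[0,T]\times\mathbb{R}^d_0$ depending on $(x,j)\in\Omega$ such that $\mu(A,x,j)=\mu(A,x_{t-},j_{t-})$ for every $t$ and $A\in\mathcal{B}([0,t]\times\mathbb{R}^d_0)$. The integral against $j-\mu$ is the pathwise integral $\int\psi\,dj-\int\psi\,d\mu$ over $[0,t]\times\mathbb{R}^d_0$ (both integrals absolutely convergent), with $\mu=\mu(\cdot,x,j)$. Vertical derivative: $\nabla_XF(t,x_t,j_t)$ is the vector with components $\lim_{h\to0}\frac1h\big(F(t,x_t^{he_i},j_t)-F(t,x_t,j_t)\big)$, $i=1,\dots,d$, where $(e_i)$ is the canonical basis and $x_t^{e}=x_t+e\,\mathbf 1_{[t,\infty)}$ for $e\in\mathbb{R}^d$ (the limits exist as part of the assertion $\nabla_XF=0$). Jump derivative: $(\nabla_JF)(t,z,x,j)=F(t,x_t,j_{t-}+\delta_{(t,z)})-F(t,x_t,j_{t-})$ for $(t,z)\in(0,T]\times\mathbb{R}^d_0$.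 *)

(* Defs.v *)
From HB Require Import structures.
From mathcomp Require Import all_boot all_order all_algebra.
From mathcomp Require Import all_classical all_reals all_analysis.
From mathcomp Require Import measurable_realfun.

Set Implicit Arguments.
Unset Strict Implicit.
Unset Printing Implicit Defensive.

Import Order.TTheory GRing.Theory Num.Theory.
Import numFieldNormedType.Exports.

Local Open Scope classical_set_scope.
Local Open Scope ring_scope.

(* The dimension, at least 1, is written d.+1, and the horizon T > 0 is an
   element of {posnum R}.  The types time T, mark R d and jspace T d are
   [0, T], R^d minus the origin, and their product. *)
Definition time (R : realType) (T : {posnum R}) : Type :=
  set_type `[0, T%:num].

Definition mark (R : realType) (d : nat) : Type :=
  set_type [set z : 'rV[R]_d.+1 | z != 0].

Definition jspace (R : realType) (T : {posnum R}) (d : nat) : Type :=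
  (time T * mark R d)%type.

Section structures.
Variables (R : realType) (T : {posnum R}) (d : nat).

HB.instance Definition _ :=
  Topological.copy (time T) (set_type `[0, T%:num]).
HB.instance Definition _ :=
  Topological.copy (mark R d) (set_type [set z : 'rV[R]_d.+1 | z != 0]).

Lemma time0_subproof : (0 : R) \in `[0, T%:num]%classic.
Proof. by rewrite inE /= in_itv /= lexx ge0. Qed.

HB.instance Definition _ := isPointed.Build (time T)
  (exist (fun t : R => t \in `[0, T%:num]%classic) 0 time0_subproof).

Lemma mark1_subproof : const_mx 1 \in [set z : 'rV[R]_d.+1 | z != 0].
Proof.
rewrite inE /=; apply/eqP => /matrixP /(_ ord0 ord0).
by rewrite !mxE => /eqP; rewrite oner_eq0.
Qed.

HB.instance Definition _ := isPointed.Build (mark R d)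
  (exist (fun z => z \in [set z : 'rV[R]_d.+1 | z != 0]) _ mark1_subproof).

HB.instance Definition _ :=
  Topological.copy (jspace T d) (time T * mark R d)%type.
HB.instance Definition _ :=
  Pointed.copy (jspace T d) (time T * mark R d)%type.

HB.instance Definition _ :=
  Measurable.copy (time T) (g_sigma_algebraType (@open (time T))).
HB.instance Definition _ :=
  Measurable.copy (jspace T d) (g_sigma_algebraType (@open (jspace T d))).

End structures.

Definition time_val (R : realType) (T : {posnum R}) (t : time T) : R := \val t.

Section cadlag_paths.
Variables (R : realType) (T : {posnum R}) (d : nat).

(* At the endpoints of [0, T] the filter of one of the two conditions is the
   trivial one, so that the condition is void there. *)
Definition cadlag (x : time T -> 'rV[R]_d.+1) :=
  forall t : time T,
    x u @[u --> within [set u | time_val t < time_val u] (nbhs t)] --> x t /\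
    cvg (x u @[u --> within [set u | time_val u < time_val t] (nbhs t)]).

Record cadlag_path := CadlagPath {
  path_fun :> time T -> 'rV[R]_d.+1;
  _ : cadlag path_fun }.

Lemma cadlag_pathP (x : cadlag_path) : cadlag x. Proof. by case: x. Qed.

(* x(t-), with the usual convention x(0-) = x(0). *)
Definition left_lim (x : time T -> 'rV[R]_d.+1) (t : time T) : 'rV[R]_d.+1 :=
  if 0 < time_val t then
    lim (x u @[u --> within [set u | time_val u < time_val t] (nbhs t)])
  else x t.

Definition stop_fun (t : time T) (x : time T -> 'rV[R]_d.+1) (u : time T) :=
  if time_val u <= time_val t then x u else x t.

Definition stopl_fun (t : time T) (x : time T -> 'rV[R]_d.+1) (u : time T) :=
  if time_val u < time_val t then x u else left_lim x t.

Definition bump_fun (t : time T) (e : 'rV[R]_d.+1)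
    (x : time T -> 'rV[R]_d.+1) (u : time T) :=
  x u + (if time_val t <= time_val u then e else 0).

Lemma nbhs_time_gt (s t : time T) : time_val s < time_val t ->
  nbhs t [set u : time T | time_val s < time_val u].
Proof.
move=> st; have c : continuous (set_val : time T -> R).
  exact: initial_continuous.
exact: (c t _ (lt_nbhsr st)).
Qed.

Lemma nbhs_time_lt (s t : time T) : time_val t < time_val s ->
  nbhs t [set u : time T | time_val u < time_val s].
Proof.
move=> ts; have c : continuous (set_val : time T -> R).
  exact: initial_continuous.
exact: (c t _ (lt_nbhsl ts)).
Qed.

Lemma cadlag_cst (e : 'rV[R]_d.+1) : cadlag (fun=> e).
Proof. by move=> t; split; [exact: cvg_cst|exact: is_cvg_cst]. Qed.


Lemma cadlag_local (x : time T -> 'rV[R]_d.+1) :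
  (forall t, exists y z, [/\ cadlag y, cadlag z, x t = y t,
     \forall u \near t, time_val t < time_val u -> x u = y u &
     \forall u \near t, time_val u < time_val t -> x u = z u]) -> cadlag x.
Proof.
move=> H t; have [y [z [/(_ t)[cy _] /(_ t)[_ cz] xy xyr xzl]]] := H t.
split.
- rewrite xy; apply: cvg_trans cy; apply: near_eq_cvg.
  by move: xyr; apply: filterS => u ? /= ?; apply/esym; auto.
- move/cvg_ex: cz => [l zl].
  apply/cvg_ex; exists l; apply: cvg_trans zl; apply: near_eq_cvg.
  by move: xzl; apply: filterS => u ? /= ?; apply/esym; auto.
Qed.

Lemma cadlag_shift (e : 'rV[R]_d.+1) (x : time T -> 'rV[R]_d.+1) :
  cadlag x -> cadlag (fun u => x u + e).
Proof.
move=> cx t; have [xr xl] := cx t; split.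
- by apply: cvgD => //; exact: cvg_cst.
- by apply: is_cvgD => //; exact: is_cvg_cst.
Qed.

Lemma stop_cadlag (t : time T) (x : cadlag_path) : cadlag (stop_fun t x).
Proof.
apply: cadlag_local => s; rewrite /stop_fun.
have cx := cadlag_pathP x; have cc := cadlag_cst (x t).
case: (ltgtP (time_val s) (time_val t)) => [st|ts|/(@val_inj _ _ (time T)) ->].
- exists x, x; split=> //; apply: filterS (nbhs_time_lt st) => u /= ut _;
    by rewrite (ltW ut).
- exists (cst (x t)), (cst (x t)); split=> //;
    by apply: filterS (nbhs_time_gt ts) => u /= tu _; rewrite leNgt tu.
- exists (cst (x t)), x; split=> //;
    apply: (@nearW _ (nbhs t)) => u /= tu.
    by rewrite leNgt tu.
  by rewrite (ltW tu).
Qed.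

Lemma stopl_cadlag (t : time T) (x : cadlag_path) : cadlag (stopl_fun t x).
Proof.
apply: cadlag_local => s; rewrite /stopl_fun.
have cx := cadlag_pathP x; have cc := cadlag_cst (left_lim x t).
case: (ltgtP (time_val s) (time_val t)) => [st|ts|/(@val_inj _ _ (time T)) ->].
- exists x, x; split=> //; apply: filterS (nbhs_time_lt st) => u /= ut _;
    by rewrite ut.
- exists (cst (left_lim x t)), (cst (left_lim x t)); split=> //;
    by apply: filterS (nbhs_time_gt ts) => u /= tu _; rewrite ltNge (ltW tu).
- exists (cst (left_lim x t)), x; split=> //;
    apply: (@nearW _ (nbhs t)) => u /= tu.
    by rewrite ltNge (ltW tu).
  by rewrite tu.
Qed.

Lemma bump_cadlag (t : time T) (e : 'rV[R]_d.+1) (x : cadlag_path) :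
  cadlag (bump_fun t e x).
Proof.
apply: cadlag_local => s; rewrite /bump_fun.
have cx := cadlag_pathP x; have cc := cadlag_shift e cx.
case: (ltgtP (time_val s) (time_val t)) => [st|ts|/(@val_inj _ _ (time T)) ->].
- exists x, x; split=> //; rewrite ?addr0//;
    by apply: filterS (nbhs_time_lt st) => u /= ut _; rewrite leNgt ut addr0.
- exists (fun u => x u + e), (fun u => x u + e); split=> //;
    by apply: filterS (nbhs_time_gt ts) => u /= tu _; rewrite (ltW tu).
- exists (fun u => x u + e), x; split=> //;
    apply: (@nearW _ (nbhs t)) => u /= tu.
    by rewrite (ltW tu).
  by rewrite leNgt tu addr0.
Qed.

(* x_t, x_{t-} and x_t^e = x_t + e 1_{[t, oo)} *)
Definition stop (t : time T) (x : cadlag_path) : cadlag_path :=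
  CadlagPath (stop_cadlag t x).
Definition stopl (t : time T) (x : cadlag_path) : cadlag_path :=
  CadlagPath (stopl_cadlag t x).
Definition vbump (t : time T) (e : 'rV[R]_d.+1) (x : cadlag_path) :
    cadlag_path :=
  CadlagPath (bump_cadlag t e (stop t x)).

End cadlag_paths.

Section jump_measures.
Local Open Scope ereal_scope.
Variables (R : realType) (T : {posnum R}) (d : nat).
Local Notation E := (jspace T d).

(* The atoms form a set, so that they are pairwise distinct ("simple").  The
   formula is required on all subsets of E, and not only on the Borel ones, so
   that two elements of jmeasure with the same atoms are equal. *)
Definition simple_integer (j : set E -> \bar R) :=
  exists S : set E, [/\ countable S,
    (forall A : set E, j A = \esum_(p in S) \d_p A) &
    forall K : set E, compact K -> j K < +oo].

Record jmeasure := JMeasure {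
  jmeasure_measure :> {measure set E -> \bar R};
  _ : simple_integer jmeasure_measure }.

Lemma jmeasureP (j : jmeasure) : simple_integer j. Proof. by case: j. Qed.

Definition upto (t : time T) : set E :=
  [set p : E | (time_val p.1 <= time_val t)%R].
Definition before (t : time T) : set E :=
  [set p : E | (time_val p.1 < time_val t)%R].

Lemma val_fst_continuous : continuous (fun p : E => time_val p.1 : R).
Proof.
move=> p; apply: (@continuous_comp E (time T) R fst set_val p).
  exact: cvg_fst.
exact: (@initial_continuous (time T) R set_val).
Qed.

Lemma measurable_upto t : measurable (upto t).
Proof.
rewrite -[upto t]setCK; apply: measurableC; apply: sub_sigma_algebra.
have -> : ~` upto t = (fun p : E => time_val p.1 : R) @^-1`
    [set s | (time_val t < s)%R].
  by apply/seteqP; split => p /=; rewrite /upto /= ltNge => /negP.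
by apply: open_comp => // p _; exact: val_fst_continuous.
Qed.

Lemma measurable_before t : measurable (before t).
Proof.
apply: sub_sigma_algebra.
have -> : before t = (fun p : E => time_val p.1 : R) @^-1`
    [set s | (s < time_val t)%R].
  by [].
by apply: open_comp => // p _; exact: val_fst_continuous.
Qed.

Lemma jrestr_subproof (j : jmeasure) (D : set E) (mD : measurable D) :
  simple_integer (mrestr j mD).
Proof.
have [S [cS jS fj]] := jmeasureP j; exists (S `&` D); split.
- by apply: sub_countable cS; exact: subset_card_le.
- move=> A; rewrite /mrestr jS esum_mkcondr; apply: eq_esum => p _.
  by rewrite !diracE in_setI; case: (p \in D); rewrite ?andbT ?andbF.
- move=> K /fj; apply: le_lt_trans; rewrite /mrestr !jS.
  apply: le_esum => p _; rewrite !diracE lee_fin ler_nat in_setI.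
  by case: (p \in K); case: (p \in D).
Qed.

Lemma jadd_subproof (j : jmeasure) (t : time T) (z : mark R d) :
  simple_integer (measure_add (mrestr j (measurable_before t))
    (\d_((t, z) : E))).
Proof.
set p := ((t, z) : E).
have [_ [_ _ fr]] := jrestr_subproof j (measurable_before t).
have [S [cS jS _]] := jmeasureP j; exists ((S `&` before t) `|` [set p]); split.
- rewrite -bigcup2E; apply: bigcup_countable; first exact: countableP.
  move=> [|[|n]] _ /=; [|exact: countable1|exact: countable0].
  by apply: sub_countable cS; exact: subset_card_le.
- have np : ~ before t p by rewrite /before /= ltxx.
  move=> A; rewrite measure_addE (esumID (before t)).
    congr (_ + _); last first.
      rewrite (_ : (_ `|` _) `&` _ = [set p]).
        by rewrite esum_set1// diracE lee_fin.
      by apply/seteqP; split=> [q [[[]//|//]]|_ ->]; split=> //; right.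
    rewrite (_ : (_ `|` _) `&` _ = S `&` before t); last first.
      by apply/seteqP; split=> [q [[//|->]//]|q [Sq bq]]; split=> //; left.
    rewrite [LHS]/= /mrestr jS esum_mkcondr; apply: eq_esum => q _.
    by rewrite !diracE in_setI; case: (q \in before t); rewrite ?andbT ?andbF.
  by move=> q _; rewrite diracE lee_fin.
- move=> K cK; rewrite measure_addE; apply: lte_add_pinfty; first exact: fr.
  by rewrite [X in X < _]/= diracE ltry.
Qed.

Lemma jzero_subproof : simple_integer (mzero : set E -> \bar R).
Proof.
exists set0; split; first exact: countable0.
  by move=> A; rewrite esum_set0.
by move=> K _; rewrite ltry.
Qed.

(* j_t, j_{t-} and j_{t-} + delta_(t, z) *)
Definition jstop (t : time T) (j : jmeasure) : jmeasure :=
  JMeasure (jrestr_subproof j (measurable_upto t)).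
Definition jstopl (t : time T) (j : jmeasure) : jmeasure :=
  JMeasure (jrestr_subproof j (measurable_before t)).
Definition jadd (t : time T) (z : mark R d) (j : jmeasure) : jmeasure :=
  JMeasure (jadd_subproof j t z).

End jump_measures.

Section canonical_space.
Variables (R : realType) (T : {posnum R}) (d : nat).

HB.instance Definition _ := gen_eqMixin (cadlag_path T d).
HB.instance Definition _ := gen_choiceMixin (cadlag_path T d).
HB.instance Definition _ :=
  isPointed.Build (cadlag_path T d) (CadlagPath (cadlag_cst 0)).

HB.instance Definition _ := gen_eqMixin (jmeasure T d).
HB.instance Definition _ := gen_choiceMixin (jmeasure T d).
HB.instance Definition _ :=
  isPointed.Build (jmeasure T d) (JMeasure (jzero_subproof T d)).

Definition path_cylinders : set (set (cadlag_path T d)) :=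
  [set C | exists (s : time T) (B : set 'rV[R]_d.+1),
     <<s @open 'rV[R]_d.+1 >> B /\ C = [set x : cadlag_path T d | B (x s)]].

Definition jmeasure_cylinders : set (set (jmeasure T d)) :=
  [set C | exists (A : set (jspace T d)) (B : set (\bar R)),
     [/\ measurable A, measurable B & C = [set j : jmeasure T d | B (j A)]]].

HB.instance Definition _ :=
  Measurable.copy (cadlag_path T d) (g_sigma_algebraType path_cylinders).
HB.instance Definition _ :=
  Measurable.copy (jmeasure T d) (g_sigma_algebraType jmeasure_cylinders).

Definition Omega : Type := (cadlag_path T d * jmeasure T d)%type.
HB.instance Definition _ := Measurable.on Omega.

(* The sigma-algebra F_t *)
Definition history (t : time T) : set (set Omega) :=
  <<s [set C : set Omega |
    (exists (s : time T) (B : set 'rV[R]_d.+1),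
       [/\ time_val s <= time_val t, <<s @open 'rV[R]_d.+1 >> B &
           C = [set w : Omega | B (w.1 s)]]) \/
    (exists (A : set (jspace T d)) (B : set (\bar R)),
       [/\ measurable A, measurable B &
           C = [set w : Omega | B (jstop t w.2 A)]])] >>.

Definition history_measurable (t : time T)
    (f : cadlag_path T d -> jmeasure T d -> R) :=
  forall B : set R, measurable B -> history t [set w : Omega | B (f w.1 w.2)].

Definition functional : Type := time T -> cadlag_path T d -> jmeasure T d -> R.
Definition functional_field : Type :=
  time T -> mark R d -> cadlag_path T d -> jmeasure T d -> R.

Definition non_anticipative (F : functional) :=
  [/\ measurable_fun [set: time T * Omega]
        (fun p : time T * Omega => F p.1 p.2.1 p.2.2),
      forall t x j, F t x j = F t (stop t x) (jstop t j) &
      forall t, history_measurable t (F t)].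

Definition predictable (F : functional) :=
  non_anticipative F /\ forall t x j, F t x j = F t (stopl t x) (jstopl t j).

Definition non_anticipative_field (psi : functional_field) :=
  [/\ measurable_fun [set: jspace T d * Omega]
        (fun q : jspace T d * Omega => psi q.1.1 q.1.2 q.2.1 q.2.2),
      forall t z x j, psi t z x j = psi t z (stop t x) (jstop t j) &
      forall t z, history_measurable t (psi t z)].

Definition compactly_supported (psi : functional_field) :=
  forall x j, exists2 K : set (jspace T d), compact K &
    forall t z, ~ K (t, z) -> psi t z x j = 0.

Definition sigma_finite_predictable
    (mu : cadlag_path T d -> jmeasure T d ->
       {measure set (jspace T d) -> \bar R}) :=
  (forall x j, sigma_finite [set: jspace T d] (mu x j)) /\
  (forall x j t (A : set (jspace T d)), measurable A -> A `<=` upto t ->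
     mu x j A = mu (stopl t x) (jstopl t j) A).

Definition has_compensated_integral
    (m n : {measure set (jspace T d) -> \bar R}) (D : set (jspace T d))
    (f : jspace T d -> R) (v : R) :=
  [/\ m.-integrable D (EFin \o f), n.-integrable D (EFin \o f) &
      v = (\int[m]_(p in D) f p) - (\int[n]_(p in D) f p)].

(* Both arguments are stopped here, so that nablaX F t depends on (x, j) only
   through (x_t, j_t). *)
Definition vertical_quotient (F : functional) (t : time T)
    (x : cadlag_path T d) (j : jmeasure T d) (i : 'I_d.+1) (h : R) : R :=
  h^-1 * (F t (vbump t (h *: delta_mx 0 i) x) (jstop t j)
          - F t (stop t x) (jstop t j)).

Definition vertically_derivable (F : functional) (t : time T)
    (x : cadlag_path T d) (j : jmeasure T d) :=
  forall i, cvg (vertical_quotient F t x j i h @[h --> 0^']).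

Definition nablaX (F : functional) (t : time T)
    (x : cadlag_path T d) (j : jmeasure T d) : 'rV[R]_d.+1 :=
  \row_i lim (vertical_quotient F t x j i h @[h --> 0^']).

Definition nablaJ (F : functional) (t : time T) (z : mark R d)
    (x : cadlag_path T d) (j : jmeasure T d) : R :=
  F t (stop t x) (jadd t z j) - F t (stop t x) (jstopl t j).

End canonical_space.

(* Main.v *)
Require Import Defs.
From HB Require Import structures.
From mathcomp Require Import all_boot all_order all_algebra.
From mathcomp Require Import all_classical all_reals all_analysis.
From mathcomp Require Import measurable_realfun.
Import Order.TTheory GRing.Theory Num.Theory.
Import numFieldNormedType.Exports.
Local Open Scope classical_set_scope.
Local Open Scope ring_scope.

(** For t > 0, every modification involved leaves the strict past of t alone:
    adding a jump of size e to the path at time t, or an atom (t, z) to the jump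
    measure, changes neither x_{t-} nor j_{t-} ([stopl_vbump], [jstopl_jadd]).

    A predictable functional at time t only sees (x_{t-}, j_{t-}), so that the
    increments defining both of its derivatives vanish identically.

    For the compensated integral, the same invariance holds at every s <= t,
    because x_{s-} and j_{s-} are functions of x_{t-} and j_{t-} ([stopl_stopl],
    [jstopl_jstopl]).  Two points of the canonical space with the same strict
    past of t thus give the same integrand on [0, t], and, mu being predictable,
    the same compensator on [0, t].  The values of the integral can only differ
    through the measures j against which the common integrand is integrated
    ([compensated_integral_diff]).  Bumping the path does not touch j, hence
    nabla_X F = 0; adding the Dirac mass at (t, z) adds the value of the
    integrand there, which is psi(t, z, x_{t-}, j_{t-}). *)

Section strict_past.
Set Implicit Arguments.
Unset Strict Implicit.
Context {R : realType} {T : {posnum R}} {d : nat}.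
Implicit Types (x y : cadlag_path T d) (j k : jmeasure T d) (s t : time T).

Lemma cadlag_path_ext x y : x =1 y -> x = y.
Proof.
case: x y => [x cx] [y cy] /= /funext xy; subst y.
by congr CadlagPath; exact: Prop_irrelevance.
Qed.

Lemma jmeasure_ext j k : (forall A, j A = k A) -> j = k.
Proof.
case: j k => [j cj] [k ck] /= jk.
have E : j = k by apply: eq_measure; apply/funext.
by subst k; congr JMeasure; exact: Prop_irrelevance.
Qed.

(** The separate condition at [t] matters only when [t] is 0, in view of the
    convention x(0-) = x(0). *)
Lemma eq_left_lim (x y : time T -> 'rV[R]_d.+1) t :
  (forall u, time_val u < time_val t -> x u = y u) ->
  (time_val t <= 0 -> x t = y t) -> left_lim x t = left_lim y t.
Proof.
move=> xy xyt; rewrite /left_lim; case: ltP => // _.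
have E (f g : time T -> 'rV[R]_d.+1) :
    (forall u, time_val u < time_val t -> f u = g u) ->
  f u @[u --> within [set u | time_val u < time_val t] (nbhs t)] `=>`
  g u @[u --> within [set u | time_val u < time_val t] (nbhs t)].
  move=> fg; apply: near_eq_cvg.
  by apply: (@nearW _ (nbhs t)) => u /= /fg ->.
congr lim; apply/seteqP; split; first by apply: E => u /xy.
exact: E.
Qed.

Lemma eq_stopl x y t :
  (forall u, time_val u < time_val t -> x u = y u) ->
  (time_val t <= 0 -> x t = y t) -> stopl t x = stopl t y.
Proof.
move=> xy xyt; apply: cadlag_path_ext => u /=; rewrite /stopl_fun.
by case: ifP => [/xy//|_]; exact: eq_left_lim.
Qed.

Lemma stopl_stopl s t x : 0 < time_val t -> time_val s <= time_val t ->
  stopl s (stopl t x) = stopl s x.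
Proof.
move=> t0 st; apply: eq_stopl => [u us|s0] /=; rewrite /stopl_fun.
  by rewrite (lt_le_trans us st).
by rewrite (le_lt_trans s0 t0).
Qed.

Lemma stop_stop t x : stop t (stop t x) = stop t x.
Proof.
apply: cadlag_path_ext => u /=; rewrite /stop_fun.
by rewrite lexx; case: (_ <= time_val t).
Qed.

Lemma stop_vbump t e x : stop t (vbump t e x) = vbump t e x.
Proof.
apply: cadlag_path_ext => u /=; rewrite /stop_fun.
case: ifPn => //; rewrite -ltNge => tu.
by rewrite /bump_fun /= /stop_fun !lexx (ltW tu) leNgt tu.
Qed.

Lemma stopl_stop t x : 0 < time_val t -> stopl t (stop t x) = stopl t x.
Proof.
move=> t0; apply: eq_stopl => [u ut|] /=; last by rewrite leNgt t0.
by rewrite /stop_fun (ltW ut).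
Qed.

Lemma stopl_vbump t e x : 0 < time_val t -> stopl t (vbump t e x) = stopl t x.
Proof.
move=> t0; apply: eq_stopl => [u ut|]; last by rewrite leNgt t0.
by rewrite /= /bump_fun /= /stop_fun (ltW ut) leNgt ut addr0.
Qed.

Lemma before_upto s t : time_val s <= time_val t ->
  (before s : set (jspace T d)) `<=` upto t.
Proof. by move=> st p /ltW /le_trans; exact. Qed.

Lemma jstopl_jstopl s t j : time_val s <= time_val t ->
  jstopl s (jstopl t j) = jstopl s j.
Proof.
move=> st; apply: jmeasure_ext => A /=; rewrite /mrestr -setIA.
congr (j (_ `&` _)); apply/setIidl => p.
by rewrite /before /= => /lt_le_trans; exact.
Qed.

Lemma jstopl_jstop t j : jstopl t (jstop t j) = jstopl t j.
Proof.
apply: jmeasure_ext => A /=; rewrite /mrestr -setIA.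
by congr (j (_ `&` _)); apply/setIidl; exact: before_upto.
Qed.

Lemma jstop_jstopl t j : jstop t (jstopl t j) = jstopl t j.
Proof.
apply: jmeasure_ext => A /=; rewrite /mrestr -setIA.
by congr (j (_ `&` _)); apply/setIidr; exact: before_upto.
Qed.

Lemma jaddE t z j A :
  jadd t z j A = (jstopl t j A + \d_((t, z) : jspace T d) A)%E.
Proof. exact: measure_addE. Qed.

Lemma jstop_jadd t z j : jstop t (jadd t z j) = jadd t z j.
Proof.
apply: jmeasure_ext => A; rewrite [LHS]/= /mrestr -/(jadd t z j _) !jaddE.
rewrite -[in RHS](jstop_jstopl t j); congr (_ + _)%E.
by rewrite !diracE in_setI [X in _ && X]mem_set ?andbT// /upto /= lexx.
Qed.

Lemma jstopl_jadd t z j : jstopl t (jadd t z j) = jstopl t j.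
Proof.
apply: jmeasure_ext => A; rewrite [LHS]/= /mrestr -/(jadd t z j _) jaddE.
rewrite diracE in_setI [X in _ && X]memNset ?andbF; last first.
  by rewrite /before /= ltxx.
by rewrite adde0 /= /mrestr -setIA setIid.
Qed.

End strict_past.

Section derivatives.
Set Implicit Arguments.
Unset Strict Implicit.
Context {R : realType} {T : {posnum R}} {d : nat}.
Implicit Types (x y : cadlag_path T d) (j k : jmeasure T d) (s t : time T).

(** The limit exists because the difference quotient is constantly 0. *)
Lemma nablaX_eq0 (F : functional T d) t x j :
  (forall e, F t (vbump t e x) (jstop t j) = F t (stop t x) (jstop t j)) ->
  vertically_derivable F t x j /\ nablaX F t x j = 0.
Proof.
move=> Fe; have q0 i : vertical_quotient F t x j i = cst 0.
  by apply/funext => h; rewrite /vertical_quotient Fe subrr mulr0.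
split=> [i|].
  by rewrite q0; exact: is_cvg_cst.
by apply/rowP => i; rewrite !mxE q0; exact: lim_cst.
Qed.

Lemma predictable_eq (F : functional T d) t x y j k : predictable F ->
  stopl t x = stopl t y -> jstopl t j = jstopl t k -> F t x j = F t y k.
Proof. by move=> [_ P] xy jk; rewrite P xy jk -P. Qed.

Lemma Rintegral_measure_add_dirac {disp} {E : measurableType disp}
    (m : {measure set E -> \bar R}) (D : set E) (a : E) (f : E -> R) :
  measurable D -> D a -> m.-integrable D (EFin \o f) ->
  \int[measure_add m (\d_a)]_(p in D) f p = \int[m]_(p in D) f p + f a.
Proof.
move=> mD Da fi; have mf := measurable_int m fi.
have da : (\int[\d_a]_(p in D) (EFin \o f) p = (f a)%:E)%E.
  by rewrite integral_dirac// diracE mem_set// mul1e.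
have fd : (\d_a).-integrable D (EFin \o f).
  apply/integrableP; split=> //.
  rewrite integral_dirac//; last exact: measurableT_comp.
  by rewrite diracE mem_set// mul1e /= ltry.
rewrite /Rintegral integral_measure_add// da.
by rewrite fineD//; exact: integrable_fin_num.
Qed.

End derivatives.

Section compensated_integral.
Set Implicit Arguments.
Unset Strict Implicit.
Context {R : realType} {T : {posnum R}} {d : nat}.
Implicit Types (x y : cadlag_path T d) (j k : jmeasure T d) (s t : time T).
Variables (mu : cadlag_path T d -> jmeasure T d ->
             {measure set (jspace T d) -> \bar R})
          (psi : functional_field T d) (F : functional T d).
Hypothesis mu_pred : sigma_finite_predictable mu.
(** The integrand psi(s, y, x_{s-}, j_{s-}) at p = (s, y). *)
Let g (x : cadlag_path T d) (j : jmeasure T d) (p : jspace T d) : R :=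
  psi p.1 p.2 (stopl p.1 x) (jstopl p.1 j).
Hypothesis FE : forall t x j,
  has_compensated_integral j (mu x j) (upto t) (g x j)
    (F t (stop t x) (jstop t j)).

Lemma integrand_eq t x y j k : 0 < time_val t ->
  stopl t x = stopl t y -> jstopl t j = jstopl t k ->
  {in upto t, g x j =1 g y k}.
Proof.
move=> t0 xy jk [s z]; rewrite inE /upto /= => st; rewrite /g /=.
rewrite -(stopl_stopl x t0 st) -(stopl_stopl y t0 st) xy.
by rewrite -(jstopl_jstopl j st) -(jstopl_jstopl k st) jk.
Qed.

(** The integrals against [mu] cancel between two points with the same strict past. *)
Lemma compensated_integral_diff t x y j k : 0 < time_val t ->
  stopl t x = stopl t y -> jstopl t j = jstopl t k ->
  F t (stop t x) (jstop t j) - F t (stop t y) (jstop t k) =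
  \int[j]_(p in upto t) g x j p - \int[k]_(p in upto t) g x j p.
Proof.
move=> t0 xy jk; have [_ _ ->] := FE t x j; have [_ _ ->] := FE t y k.
have gE := integrand_eq t0 xy jk.
have muE : \int[mu x j]_(p in upto t) g x j p =
           \int[mu y k]_(p in upto t) g y k p.
  rewrite (eq_Rintegral _ gE) /Rintegral; congr fine.
  apply: eq_measure_integral => A mA At.
  have [_ muP] := mu_pred.
  by rewrite (muP x j t)// (muP y k t)// xy jk.
rewrite muE (eq_Rintegral k gE).
by rewrite opprB addrA subrK.
Qed.

Lemma nablaX_compensated_integral t x j : 0 < time_val t ->
  vertically_derivable F t (stop t x) (jstop t j) /\
  nablaX F t (stop t x) (jstop t j) = 0.
Proof.
move=> t0; apply: nablaX_eq0 => e; apply/eqP; rewrite -subr_eq0.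
rewrite -stop_vbump compensated_integral_diff ?subrr//.
exact: stopl_vbump.
Qed.

Lemma nablaJ_compensated_integral t z x j : 0 < time_val t ->
  nablaJ F t z (stop t x) (jstop t j) = psi t z (stopl t x) (jstopl t j).
Proof.
move=> t0; rewrite /nablaJ.
rewrite -[X in F t _ X - _](jstop_jadd t z).
rewrite -[X in _ - F t _ X]jstop_jstopl.
set a := jadd t z (jstop t j); set b := jstopl t (jstop t j).
have ab : jstopl t a = jstopl t b.
  by rewrite jstopl_jadd /b jstopl_jstopl.
rewrite compensated_integral_diff//.
have [gi _ _] := FE t (stop t x) b.
(* a is the sum of b and the Dirac mass at (t, z) *)
rewrite (_ : \int[a]_(p in upto t) _ =
    \int[b]_(p in upto t) g (stop t x) a p + g (stop t x) a (t, z)).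
  rewrite addrAC subrr add0r /g /= stopl_stop//.
  by rewrite jstopl_jadd jstopl_jstop.
apply: (Rintegral_measure_add_dirac (m := b)).
- exact: measurable_upto.
- by rewrite /upto /= lexx.
- apply: eq_integrable gi; first exact: measurable_upto.
  by move=> p pt /=; rewrite (integrand_eq (x := stop t x) (j := a) t0 erefl ab).
Qed.

End compensated_integral.

Theorem proposition2p10 (R : realType) (T : {posnum R}) (d : nat) :
  (forall F : functional T d, predictable F ->
     forall (x : cadlag_path T d) (j : jmeasure T d) (t : time T) (z : mark R d),
       0 < time_val t ->
       (vertically_derivable F t (stop t x) (jstop t j) /\
        nablaX F t (stop t x) (jstop t j) = 0) /\
       nablaJ F t z x j = 0) /\
  (forall (mu : cadlag_path T d -> jmeasure T d ->
             {measure set (jspace T d) -> \bar R})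
          (psi : functional_field T d) (F : functional T d),
     sigma_finite_predictable mu ->
     non_anticipative_field psi ->
     compactly_supported psi ->
     non_anticipative F ->
     (forall (t : time T) (x : cadlag_path T d) (j : jmeasure T d),
        has_compensated_integral j (mu x j) (upto t)
          (fun p => psi p.1 p.2 (stopl p.1 x) (jstopl p.1 j))
          (F t (stop t x) (jstop t j))) ->
     forall (x : cadlag_path T d) (j : jmeasure T d) (t : time T) (z : mark R d),
       0 < time_val t ->
       nablaJ F t z (stop t x) (jstop t j) = psi t z (stopl t x) (jstopl t j) /\
       (vertically_derivable F t (stop t x) (jstop t j) /\
        nablaX F t (stop t x) (jstop t j) = 0)).
Proof.
split=> [F Fp x j t z t0|mu psi F muP _ _ _ FE x j t z t0]; last first.
  split; first exact: (nablaJ_compensated_integral muP).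
  exact: (nablaX_compensated_integral muP FE).
split.
  apply: nablaX_eq0 => e; apply: predictable_eq => //.
  by rewrite stopl_vbump// stop_stop.
rewrite /nablaJ (predictable_eq (k := jstopl t j) Fp (erefl _)) ?subrr//.
by rewrite jstopl_jadd jstopl_jstopl.
Qed.
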